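(* Suppose $\eta$ is a random particle configuration whose path encoding has distribution supported in $\mathcal{S}_{sub-critical}$. (a) It holds that $T\eta\overset{d}{=}\eta$ if and only if $((T^kW)_0)_{k\in\mathbb{Z}}$ is stationary under $\theta$. (b) The configuration $\eta$ is invariant and ergodic under $T$ if and only if $((T^kW)_0)_{k\in\mathbb{Z}}$ is stationary and ergodic under $\theta$.
   Context: A particle configuration is $\eta=(\eta_n)_{n\in\mathbb{Z}}\in\{0,1\}^{\mathbb{Z}}$. Its path encoding is $S=(S_n)_{n\in\mathbb{Z}}$ with $S_0=0$, $S_n-S_{n-1}=1-2\eta_n$; this identifies $\{0,1\}^{\mathbb{Z}}$ with $\mathcal{S}^0=\{S:\mathbb{Z}\to\mathbb{Z} : S_0=0,\ |S_n-S_{n-1}|=1\ \forall n\}$. Let $M_n=\sup_{m\le n}S_m$, $I_n=\inf_{m\ge n}S_m$. When $M_0<\infty$, $(TS)_n=2M_n-S_n-2M_0$; when $I_0>-\infty$, $(T^{-1}S)_n=2I_n-S_n-2I_0$. $T\eta$ is the configuration with path encoding $TS$, and $T^k$ ($k\in\mathbb{Z}$) denotes the iterates of $T$ (for $k\geq 0$) or of $T^{-1}$ (for $k<0$). Let $\mathcal{S}_{sub-critical}=\mathcal{S}_{sub-critical}^-\cap\mathcal{S}_{sub-critical}^+$, where $\mathcal{S}_{sub-critical}^{\pm}$ is the set of $S\in\mathcal{S}^0$ with $\lim_{n\to\pm\infty}S_n/F(n)=1$ for some strictly increasing $F:\mathbb{Z}\to\mathbb{R}$. On this set all $T^kS$,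 $k\in\mathbb{Z}$, are well-defined and $T,T^{-1}$ are mutually inverse. The carrier process is $W=M-S$, and $T^kW$ denotes the carrier process of $T^kS$, i.e. $(T^kW)_n=\sup_{m\le n}(T^kS)_m-(T^kS)_n$. $\theta$ is the canonical shift $\theta((x_k)_{k\in\mathbb{Z}})=(x_{k+1})_{k\in\mathbb{Z}}$. ''Invariant (ergodic) under $T$'' refers to the law of $\eta$. *)

(* Defs.v *)
From HB Require Import structures.
From mathcomp Require Import all_boot all_order all_algebra.
From mathcomp Require Import all_classical all_reals all_analysis.
From mathcomp Require Import zify.

Set Implicit Arguments.
Unset Strict Implicit.
Unset Printing Implicit Defensive.

Import Order.TTheory GRing.Theory Num.Theory.
Import numFieldNormedType.Exports.

Local Open Scope classical_set_scope.
Local Open Scope ring_scope.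

HB.instance Definition _ := isPointed.Build int 0.

HB.instance Definition _ := @isMeasurable.Build default_measure_display
  int discrete_measurable discrete_measurable0
  discrete_measurableC discrete_measurableU.

Definition cylinders {d} (V : measurableType d) : set (set (int -> V)) :=
  \bigcup_k preimage_set_system setT (fun x : int -> V => x k) measurable.
Arguments cylinders {d} V.

Definition biseq {d} (V : measurableType d) : Type :=
  g_sigma_algebraType (cylinders V).
Arguments biseq {d} V.

HB.instance Definition _ d (V : measurableType d) :=
  Measurable.copy (biseq V) (g_sigma_algebraType (cylinders V)).

Definition biseq_shift {d} (V : measurableType d) (x : biseq V) : biseq V :=
  fun k => x (k + 1).
Arguments biseq_shift {d} V x.

Definition same_law {d d'} {Omega : measurableType d} {V : measurableType d'}
    {R : realType} (P : probability Omega R) (X Y : Omega -> V) : Prop :=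
  forall A : set V, measurable A -> pushforward P X A = pushforward P Y A.

Definition preserves {d} {V : measurableType d} {R : realType}
    (mu : set V -> \bar R) (f : V -> V) : Prop :=
  forall A : set V, measurable A -> pushforward mu f A = mu A.

(* The transformation [f] is only meaningful on [D]; invariance of an event is
   required there only, so that the values of [f] outside [D] play no role. *)
Definition ergodic_on {d} {V : measurableType d} {R : realType} (D : set V)
    (mu : set V -> \bar R) (f : V -> V) : Prop :=
  forall A : set V, measurable A -> D `&` f @^-1` A = D `&` A ->
    mu A = 0%E \/ mu A = 1%E.

Definition configuration : Type := biseq bool.

HB.instance Definition _ := Measurable.copy configuration (biseq bool).

(* The increment S_n - S_(n-1). *)
Definition increment (eta : configuration) (n : int) : int :=
  1 - 2 * (nat_of_bool (eta n))%:Z.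

Definition path_encoding (eta : configuration) (k : int) : int :=
  match k with
  | Posz n => \sum_(i < n) increment eta i.+1%:Z
  | Negz n => - \sum_(i < n.+1) increment eta (- i%:Z)
  end.

Definition config_of_path (S : int -> int) : configuration :=
  fun n => S n - S (n - 1) == - 1.

Definition is_path (S : int -> int) : Prop :=
  S 0 = 0 /\ forall n, `|S n - S (n - 1)| = 1.

Lemma path_encodingB eta n :
  path_encoding eta n - path_encoding eta (n - 1) = increment eta n.
Proof.
case: n => [[|n]|n].
- rewrite (_ : Posz 0 - 1 = Negz 0) // /path_encoding big_ord0 big_ord_recr big_ord0 /=.
  by rewrite !add0r opprK oppr0.
- rewrite (_ : Posz n.+1 - 1 = Posz n) /=; last by lia.
  by rewrite big_ord_recr /= addrAC subrr add0r.
- rewrite (_ : Negz n - 1 = Negz n.+1) /=; last by lia.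
  by rewrite [in X in _ - - X]big_ord_recr /= opprK addrA addNr add0r NegzE.
Qed.

Lemma path_encoding_is_path eta : is_path (path_encoding eta).
Proof.
split=> [|n]; first exact: big_ord0.
by rewrite path_encodingB /increment; case: (eta n).
Qed.

Lemma path_encodingK : cancel path_encoding config_of_path.
Proof.
move=> eta; apply/funext => n; rewrite /config_of_path path_encodingB /increment.
by case: (eta n).
Qed.

Lemma is_path_eq S S' : is_path S -> is_path S' ->
  (forall n, S n - S (n - 1) = S' n - S' (n - 1)) -> S = S'.
Proof.
move=> [S0 _] [S'0 _] h; apply/funext; elim/int_ind => [|n IH|n IH].
- by rewrite S0 S'0.
- have := h (n.+1%:Z); rewrite (_ : n.+1%:Z - 1 = n%:Z) ; last by lia.
  by rewrite IH => /addIr.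
- have := h (- n%:Z); rewrite (_ : - n%:Z - 1 = - n.+1%:Z) ; last by lia.
  by rewrite IH => /addrI /oppr_inj.
Qed.

Lemma config_of_pathK S : is_path S -> path_encoding (config_of_path S) = S.
Proof.
move=> pS; apply: (is_path_eq (path_encoding_is_path _) pS) => n.
rewrite path_encodingB /increment /config_of_path.
have := pS.2 n; case: eqP => [->|] //=; lia.
Qed.

(* Junk value 0 when the supremum (resp. infimum) is infinite; this never
   happens along the iterates of a sub-critical path. *)
Definition past_max (S : int -> int) (n : int) : int :=
  supremum 0 [set S m | m in [set m | m <= n]].
Definition future_min (S : int -> int) (n : int) : int :=
  infimum 0 [set S m | m in [set m | n <= m]].

Definition pitman (S : int -> int) : int -> int :=
  fun n => 2 * past_max S n - S n - 2 * past_max S 0.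
Definition pitman_inv (S : int -> int) : int -> int :=
  fun n => 2 * future_min S n - S n - 2 * future_min S 0.

Definition pitman_iter (k : int) (S : int -> int) : int -> int :=
  match k with
  | Posz n => iter n pitman S
  | Negz n => iter n.+1 pitman_inv S
  end.

Definition carrier (S : int -> int) : int -> int :=
  fun n => past_max S n - S n.

Definition bbs (eta : configuration) : configuration :=
  config_of_path (pitman (path_encoding eta)).

Definition carrier_at_origin (eta : configuration) : biseq int :=
  fun k => carrier (pitman_iter k (path_encoding eta)) 0.

Lemma past_maxP S n : has_ubound [set S m | m in [set m | m <= n]] ->
  (exists2 m, m <= n & S m = past_max S n) /\ forall m, m <= n -> S m <= past_max S n.
Proof.
move=> [b ub].
have ub' : forall m, m <= n -> S m <= b by move=> m mn; apply: ub; exists m.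
have [m0 m0n max] : exists2 m0, m0 <= n & forall m, m <= n -> S m <= S m0.
  have ex : exists k : nat, `[< exists2 m, m <= n & b - S m = k%:Z >].
    exists `|b - S n|%N; apply/asboolP; exists n => //.
    have := ub' n (lexx _); lia.
  case: (ex_minnP ex) => k /asboolP [m0 m0n e] min.
  exists m0 => // m mn.
  have h := ub' m mn.
  have /min : `[< exists2 m', m' <= n & b - S m' = `|b - S m|%N%:Z >].
    by apply/asboolP; exists m => //; lia.
  lia.
have sup : supremums [set S m | m in [set m | m <= n]] (S m0).
  split=> [_ [m mn <-]|c ubc]; first exact: max.
  by apply: ubc; exists m0.
have -> : past_max S n = S m0.
  rewrite /past_max /supremum; case: ifPn => [/eqP A0|_].
    by have := sup; rewrite A0 => -[_ /(_ (S m0 - 1))] /(_ (fun _ h => False_ind _ h)) ; move: (S m0) => x; rewrite (_ : (x <= x - 1)%O = false) //; apply/negP; lia.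
  by apply: (@is_subset1_supremums _ _ _ _ _ (xgetI _ sup) sup).
by split; [exists m0|].
Qed.

Lemma pitman_is_path S : is_path S ->
  has_ubound [set S m | m in [set m | m <= 0]] -> is_path (pitman S).
Proof.
move=> [S0 Sd] [b ub].
have step k : S k - S (k - 1) = 1 \/ S k - S (k - 1) = - 1.
  have := Sd k; lia.
have hub (n : int) : has_ubound [set S m | m in [set m | m <= n]].
  have ub' : forall m, m <= 0 -> S m <= b by move=> m mn; apply: ub; exists m.
  have ub2 (k : nat) : forall m : int, m <= k%:Z -> S m <= b + k%:Z.
    elim: k => [|k IH] m mk; first by have := ub' m mk; lia.
    case: (ltP k%:Z m) => h; last by have := IH m h; lia.
    have := IH (m - 1); have := step m; lia.
  by exists (b + `|n|%N%:Z) => _ [m mn <-]; apply: ub2; move: mn => /=; lia.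
split=> [|n]; first by rewrite /pitman S0; lia.
rewrite /pitman.
have [[m mn me] mM] := past_maxP (hub n).
have [[m' mn' me'] mM'] := past_maxP (hub (n - 1)).
have := step n.
have h1 : past_max S (n - 1) <= past_max S n by rewrite -me'; apply: mM; lia.
have h3 : S n <= past_max S n := mM n (lexx _).
have h4 : S (n-1) <= past_max S (n-1) := mM' (n-1) (lexx _).
case: (ltP m n) => h.
  have : past_max S n <= past_max S (n - 1) by rewrite -me; apply: mM'; lia.
  lia.
have mm : m = n by move: mn h; lia.
rewrite mm in me; lia.
Qed.

Lemma path_encoding_bbs eta :
  has_ubound [set path_encoding eta m | m in [set m | m <= 0]] ->
  path_encoding (bbs eta) = pitman (path_encoding eta).
Proof.
by move=> h; apply: config_of_pathK; apply: pitman_is_path => //; exact: path_encoding_is_path.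
Qed.

Definition subcritical_neg (R : realType) : set (int -> int) :=
  [set S | is_path S /\ exists F : int -> R, {homo F : m n / m < n} /\
     (fun n : nat => (S (- n%:Z))%:~R / F (- n%:Z)) @ \oo --> (1 : R)].

Definition subcritical_pos (R : realType) : set (int -> int) :=
  [set S | is_path S /\ exists F : int -> R, {homo F : m n / m < n} /\
     (fun n : nat => (S n%:Z)%:~R / F n%:Z) @ \oo --> (1 : R)].

Definition subcritical (R : realType) : set (int -> int) :=
  subcritical_neg R `&` subcritical_pos R.

Definition subcritical_config (R : realType) : set configuration :=
  path_encoding @^-1` subcritical R.

(* Main.v *)
(** The carriers [W_n^(k)] and occupations [s_n^(k)] of site [n] at time [k] obey
the local rule [s_n^(k+1) = 1] iff [s_n^(k) = 0] and [W_(n-1)^(k) > 0], which is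
invariant under reversing both space and time. An empty carrier
[W_(n-1)^(k) = 0] forces [s_n^(k+1) = 0], so [s_n] and then [W_n] can be
computed from [W_(n-1)] whenever the latter vanishes at arbitrarily negative
times; by reversal [W_n] determines [s_n] and [W_(n-1)] if it vanishes at
arbitrarily large times. Sub-criticality alone does not ensure this (solitons
growing fast enough keep the carrier at the origin occupied forever, and then
[(T^k W)_0] does not determine the configuration), but stationarity does. By
Poincare recurrence every finite window of [(T^k W)_0] almost surely recurs at
even time shifts in both directions. Recurrence passes from one site to the
next, and a recurrent carrier sequence which never vanishes makes every site to
its left alternate in time, so that [M] is constant there, contradicting
[S_n -> -oo]. Hence, on a set of full measure, [(T^k W)_0] determines [eta]
through a measurable map conjugating the shift to [T]. *)

Require Import Defs.
From mathcomp Require Import all_boot all_order all_algebra.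
From mathcomp Require Import all_classical all_reals all_analysis.
From mathcomp Require Import zify ring lra.

Import Order.TTheory GRing.Theory Num.Theory.
Import numFieldNormedType.Exports.

Local Open Scope classical_set_scope.
Local Open Scope ring_scope.

(** * The local rule in space-time *)

(** Space-time is read by columns: [u] and [v] are the carriers at sites n-1 and n, and [s] is the
    occupation of site n, all as functions of time. *)
Definition bbs_step (u : int -> int) (s : int -> bool) (v : int -> int) : Prop :=
  [/\ forall k, 0 <= u k,
      forall k, s (k + 1) = ~~ s k && (0 < u k) &
      forall k, v k = if s k then u k + 1 else Num.max (u k - 1) 0].

Definition time_rev (u : int -> int) : int -> int := fun k => u (- k).

(** The update at time k turns [s k] into [s (k + 1)], so reversal reflects the carriers about time
    0 but the occupations about time 1/2. *)
Lemma bbs_step_rev u s v : bbs_step u s v ->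
  bbs_step (time_rev v) (fun k => s (1 - k)) (time_rev u).
Proof.
move=> [u0 hs hv]; rewrite /time_rev; split=> k.
- by rewrite hv; have := u0 (- k); case: (s _); lia.
- have -> : 1 - (k + 1) = - k by lia.
  have -> : 1 - k = - k + 1 by lia.
  by rewrite hs hv; have := u0 (- k); case: (s (- k)) => /=; lia.
- have -> : 1 - k = - k + 1 by lia.
  by rewrite hs hv; have := u0 (- k); case: (s (- k)) => /=; [lia|case: ifP; lia].
Qed.

(** Both time directions are required so that the notion survives reversal; the lag is even so that
    a return also preserves alternating sequences. *)
Definition even_recurrent (u : int -> int) : Prop := forall N K : nat,
  (exists2 p : int, K%:Z <= p & forall k, `|k| <= N%:Z -> u (k + 2 * p) = u k) /\
  (exists2 p : int, p <= - K%:Z & forall k, `|k| <= N%:Z -> u (k + 2 * p) = u k).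

Lemma even_recurrent_rev u : even_recurrent u -> even_recurrent (time_rev u).
Proof.
move=> r N K; have [[p Kp hp] [q Kq hq]] := r N K; rewrite /time_rev; split.
  exists (- q) => [|k kN]; first lia.
  by rewrite -(hq (- k)); [congr u|]; lia.
exists (- p) => [|k kN]; first lia.
by rewrite -(hp (- k)); [congr u|]; lia.
Qed.

(* A site is vacated by an empty carrier and then alternates until the next one,
   so its occupation at time [k] is the parity of the delay since the last one. *)
Definition occupation (u : int -> int) (k : int) : bool :=
  `[< exists j : nat, [/\ u (k - 1 - j%:Z) = 0,
        forall i : nat, (i < j)%N -> u (k - 1 - i%:Z) != 0 & odd j] >].

Definition next_carrier (u : int -> int) : int -> int :=
  fun k => if occupation u k then u k + 1 else Num.max (u k - 1) 0.

Lemma bbs_step_parity u s v (j : nat) k : bbs_step u s v ->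
  u (k - 1 - j%:Z) = 0 -> (forall i : nat, (i < j)%N -> u (k - 1 - i%:Z) != 0) ->
  s k = odd j.
Proof.
move=> [u0 hs _]; elim: j k => [|j IH] k h0 hpos; have := hs (k - 1); rewrite subrK => ->.
  by move: h0; rewrite subr0 => ->; rewrite ltxx andbF.
rewrite (IH (k - 1)) /=.
- have := hpos 0%N isT; have := u0 (k - 1); rewrite subr0 => ? ?.
  by rewrite (_ : 0 < u _) ?andbT//; lia.
- by rewrite -h0; congr u; lia.
- move=> i ij; have := hpos i.+1 ij; congr (u _ != 0); lia.
Qed.

Lemma bbs_step_occupation u s v : bbs_step u s v -> even_recurrent u ->
  (exists k, u k = 0) -> s = occupation u.
Proof.
move=> st r [z uz]; apply/funext => k.
have ex : exists j : nat, u (k - 1 - j%:Z) == 0.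
  (* This lag moves the zero [z] to a time before [k]. *)
  have [_ [p pK hp]] := r `|z|%N (`|k| + `|z| + 1)%N.
  exists (absz (k - 1 - (z + 2 * p))%R); apply/eqP; rewrite -uz -(hp z); [congr u|]; lia.
case: (ex_minnP ex) => j /eqP uj minj.
have nz i : (i < j)%N -> u (k - 1 - i%:Z) != 0.
  by move=> ij; apply/negP => /minj; lia.
rewrite (bbs_step_parity u s v j k)//; apply/idP/asboolP => [oj|[j' [uj' nz' oj']]].
  by exists j.
suff -> : j = j' by [].
have := minj j'; rewrite uj' eqxx => /(_ isT) le.
case: (ltnP j j') => lt; last by lia.
by have := nz' j lt; rewrite uj eqxx.
Qed.

(** From a zero [z] of [u] left of the window, [s] is computed forward from [u] alone, so a lag that
    repeats [u] on a window containing [z] repeats [s], and hence [v]. *)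
Lemma bbs_step_even_recurrent u s v : bbs_step u s v -> even_recurrent u ->
  (exists k, u k = 0) -> even_recurrent v.
Proof.
move=> [u0 hs hv] r [z0 uz0] N K.
have [z zN uz] : exists2 z, z < - N%:Z & u z = 0.
  have [_ [p pK hp]] := r `|z0|%N (N + `|z0| + 1)%N.
  by exists (z0 + 2 * p); [lia|rewrite hp //; lia].
have key p : (forall k, `|k| <= (`|z| + N)%N%:Z -> u (k + 2 * p) = u k) ->
    forall k, `|k| <= N%:Z -> v (k + 2 * p) = v k.
  move=> hp.
  have sE (i : nat) : z + 1 + i%:Z <= N%:Z ->
      s (z + 1 + i%:Z + 2 * p) = s (z + 1 + i%:Z).
    elim: i => [|i IH] iN.
      rewrite addr0 addrAC !hs hp; last by lia.
      by rewrite uz ltxx !andbF.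
    rewrite (_ : _ + 2 * p = z + 1 + i%:Z + 2 * p + 1); last by lia.
    rewrite (_ : _ + i.+1%:Z = z + 1 + i%:Z + 1); last by lia.
    by rewrite !hs IH ?hp//; lia.
  move=> k kN; rewrite !hv hp; last by lia.
  have := sE (absz (k - z - 1)%R); rewrite (_ : z + 1 + _ = k); last by lia.
  by move=> ->//; lia.
have [[p pK hp] [q qK hq]] := r (`|z| + N)%N K.
by split; [exists p|exists q] => //; apply: key.
Qed.

Lemma odd_absz_double (k p : int) : odd (absz (k + 2 * p)) = odd (absz k).
Proof.
elim/int_ind: p => [|n|n]; first by rewrite mulr0 addr0.
  rewrite (_ : k + 2 * n.+1 = k + 2 * n%:Z + 1 + 1); lia.
rewrite (_ : k + 2 * (- n%:Z) = k + 2 * - n.+1%:Z + 1 + 1); lia.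
Qed.

Definition alternating_sign (k : int) : int := if odd (absz k) then -1 else 1.

Lemma alternating_signE j k : alternating_sign j =
  if odd (absz (j - k)%R) then - alternating_sign k else alternating_sign k.
Proof.
have -> : odd (absz (j - k)%R) = odd (absz j) (+) odd (absz k).
  by rewrite -{1}(odd_absz_double (j - k) k) (_ : j - k + 2 * k = j + k); lia.
by rewrite /alternating_sign; case: (odd _); case: (odd _).
Qed.

Section spacetime.
Variables (f : int -> int -> int) (s : int -> int -> bool).
Hypothesis fs : forall n, bbs_step (f (n - 1)) (s n) (f n).

Local Notation sg := alternating_sign.

(* Without empty carriers at the origin, two consecutive time steps always
   carry the same total through each site to the left: the carriers at two
   sites differ by an alternating sequence, and at every site particle and hole
   alternate in time. *)
Lemma no_vacancy n : even_recurrent (f n) -> (forall k, f n k != 0) ->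
  forall m k, m <= n -> s m k || (0 < f (m - 1) k).
Proof.
move=> r nz.
have f0 m k : 0 <= f m k.
  by have [+ _ _] := fs (m + 1); rewrite addrK; apply.
have alt m a : (forall k, f m k = f n k + sg k * a) ->
    forall k, s m (k + 1) = ~~ s m k.
  move=> fm.
  have [_ hs hv] := fs m.
  have bwd k : s m k = ~~ s m (k + 1) && (0 < f m k).
    have [/(_ k) u0 _ _] := fs m.
    rewrite hs hv; case: (s m k) => /=; lia.
  case: (pselect (exists k, f m k = 0)) => [[k0 fk0]|nz'] k; last first.
    have -> : s m k = ~~ s m (k + 1) && true.
      rewrite bwd; congr andb; have := f0 m k.
      have : f m k != 0 by apply/eqP => e; apply: nz'; exists k.
      lia.
    by rewrite andbT negbK.
  (* The zero at [k0] forces [sg k0 * a = - f n k0 < 0], so the alternating term is positive at odd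
     distance from [k0]. *)
  have par j : odd (absz (j - k0)%R) -> 0 < f m j.
    move=> oj; rewrite fm; have := fk0; rewrite fm.
    rewrite (alternating_signE j k0) oj mulNr.
    move: (f n k0) (f n j) (sg k0 * a) (f0 n k0) (nz k0) (f0 n j) (nz j).
    clear; lia.
  (* Backward from a zero of [f m]: a hole, then a particle, because [par] makes the carrier
     positive there, then a hole again. *)
  have zero (i : nat) : forall z, f m z = 0 -> ~~ odd (absz (z - k0)%R) ->
      s m (z - (2 * i)%N%:Z) = false.
    elim: i => [|i IH] z fz zk; first by rewrite subr0 bwd fz ltxx andbF.
    have e1 := bwd (z - (2 * i)%N%:Z - 1); rewrite subrK IH//= par in e1; last by lia.
    have := bwd (z - (2 * i.+1)%N%:Z).
    by rewrite (_ : z - (2 * i.+1)%N%:Z + 1 = z - (2 * i)%N%:Z - 1) ?e1//; lia.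
  have even0 j : ~~ odd (absz (j - k0)%R) -> s m j = false.
    (* An even lag keeps both [sg] and the value of [f n], so it carries the zero of [f m] to the
       right of [j] without changing its parity. *)
    move=> ej; have [[p pK hp] _] := r `|k0|%N (`|j| + `|k0|)%N.
    have fz : f m (k0 + 2 * p) = 0.
      rewrite fm hp//.
      have -> : sg (k0 + 2 * p) = sg k0 by rewrite /alternating_sign odd_absz_double.
      by rewrite -fm.
    have [i ->] : exists i : nat, j = k0 + 2 * p - (2 * i)%N%:Z.
      have := odd_absz_double (k0 - j) p.
      by exists (absz (k0 + 2 * p - j)%R)./2; lia.
    by apply: zero => //; rewrite addrAC odd_absz_double; lia.
  have parS j : odd (absz (j + 1 - k0)%R) = ~~ odd (absz (j - k0)%R) by clear; lia.
  case: (boolP (odd (absz (k - k0)%R))) => ok.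
    have e : s m (k + 1) = false by apply: even0; rewrite parS negbK.
    by rewrite e bwd e par.
  have e : s m (k + 1 + 1) = false by apply: even0; rewrite !parS negbK.
  by rewrite (even0 k ok) bwd e par// parS.
have shape (j : nat) : exists a, forall k, f (n - j%:Z) k = f n k + sg k * a.
  elim: j => [|j [a ha]]; first by exists 0 => k; rewrite subr0 mulr0 addr0.
  have al := alt _ _ ha.
  have [u0 hs hv] := fs (n - j%:Z).
  (* A particle adds one to the carrier; a hole is followed by a particle, so the incoming carrier
     is positive and loses exactly one. These changes alternate in time, with the sign fixed at time
     0. *)
  exists (if s (n - j%:Z) 0 then a - 1 else a + 1).
  have als k : s (n - j%:Z) k = s (n - j%:Z) 0 (+) odd `|k|%N.
    elim/int_ind: k => [|k IH|k IH].
    - by rewrite addbF.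
    - rewrite {1}(_ : k.+1%:Z = k%:Z + 1); last by clear; lia.
      by rewrite al IH /=; case: (s _ 0); case: (odd k).
    - have := al (- k.+1%:Z); rewrite (_ : - _ + 1 = - k%:Z); last by clear; lia.
      by rewrite IH !abszN /=; case: (s _ 0); case: (s _ _); case: (odd k).
  move=> k; rewrite (_ : n - j.+1%:Z = n - j%:Z - 1); last by lia.
  have := hv k; have := esym (hs k); have := u0 k; rewrite al ha /alternating_sign als.
  move: (f (n - j%:Z - 1) k) (f n k) => x y.
  by case: (s _ 0); case: (odd _) => /=; clear; lia.
move=> m k mn.
have [a] := shape (absz (n - m)%R); rewrite (_ : n - _ = m); last by lia.
move=> /alt /(_ k) e; have [_ /(_ k) + _] := fs m; rewrite e.
by case: (s m k) => //= <-.
Qed.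

End spacetime.

(** * Pitman's transformation of paths with drift *)

Lemma path_lipschitz S : is_path S -> forall n, `|S n| <= `|n|.
Proof.
move=> [S0 Sd] n; elim/int_ind: n => [|n IH|n IH].
- by rewrite S0.
- have := Sd n.+1; rewrite (_ : n.+1%:Z - 1 = n%:Z); last by lia.
  by move: IH; lia.
- have := Sd (- n%:Z); rewrite (_ : - n%:Z - 1 = - n.+1%:Z); last by lia.
  by move: IH; lia.
Qed.

Definition left_drift (S : int -> int) : Prop :=
  forall A : int, exists N : nat, forall m, m <= - N%:Z -> S m <= A.

(** A half turn of the graph: it reverses the order of the increments and exchanges past maxima with
    future minima, which transfers results from left to right and from [pitman] to [pitman_inv]. *)
Definition mirror (S : int -> int) : int -> int := fun n => - S (- n).

Lemma mirrorK : involutive mirror.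
Proof. by move=> S; apply/funext => n; rewrite /mirror !opprK. Qed.

Lemma mirror_is_path S : is_path S -> is_path (mirror S).
Proof.
move=> [S0 Sd]; split=> [|n]; rewrite /mirror ?oppr0 ?S0 //.
have := Sd (- n + 1); rewrite addrK (_ : - (n - 1) = - n + 1); lia.
Qed.

Lemma left_drift_ub S : is_path S -> left_drift S ->
  forall n, has_ubound [set S m | m in [set m | m <= n]].
Proof.
move=> pS dS n; have [N hN] := dS 0; have lip := path_lipschitz S pS.
exists (N%:Z + `|n|) => _ [m /= mn <-].
by case: (leP m (- N%:Z)) => [/hN|]; have := lip m; lia.
Qed.

Lemma past_max_eq S n c : (exists2 m, m <= n & S m = c) ->
  (forall m, m <= n -> S m <= c) -> past_max S n = c.
Proof.
move=> [m mn Sm] ub.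
have hub : has_ubound [set S m | m in [set m | m <= n]].
  by exists c => _ [k kn <-]; exact: ub.
have [[m' mn' Sm'] ub'] := past_maxP hub.
by apply/eqP; rewrite eq_le -{1}Sm' -{2}Sm ub ?ub'.
Qed.

(** Knowing the default value makes [future_min_mirror] unconditional and [past_max] measurable on
    all configurations. *)
Lemma past_max_unbounded S n :
  ~ has_ubound [set S m | m in [set m | m <= n]] -> past_max S n = 0.
Proof.
move=> nub; rewrite /past_max /supremum; case: ifPn => // _.
by apply: xgetPN => c [ubc _]; apply: nub; exists c.
Qed.

Lemma future_min_mirror S n : future_min S n = - past_max (mirror S) (- n).
Proof.
case: (pselect (has_ubound [set mirror S m | m in [set m | m <= - n]])) => [ub|nub].
  have [[m mn <-] max] := past_maxP ub.
  have inf : infimums [set S k | k in [set k | n <= k]] (- mirror S m).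
    rewrite /mirror opprK; split=> [_ [k /= nk <-]|c].
      by have := max (- k); rewrite /mirror !opprK; lia.
    by apply; exists (- m) => //=; lia.
  rewrite /future_min /infimum; case: ifPn => [/eqP e|_].
    suff : (set0 : set int) (S n) by [].
    by rewrite -e; exists n => /=.
  exact: (is_subset1_infimums (xgetI _ inf) inf).
rewrite past_max_unbounded// oppr0 /future_min /infimum; case: ifPn => // _.
apply: xgetPN => c [lbc _]; apply: nub; exists (- c) => _ [m /= mn <-].
by rewrite /mirror lerN2; apply: lbc; exists (- m) => //=; lia.
Qed.

Lemma pitman_inv_mirror S : pitman_inv S = mirror (pitman (mirror S)).
Proof.
apply/funext => n; rewrite /pitman_inv !future_min_mirror /mirror /pitman oppr0 !opprK; ring.
Qed.

Section path_with_drift.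
Variable S : int -> int.
Hypotheses (pS : is_path S) (dS : left_drift S).

Let ub n := left_drift_ub S pS dS n.

Lemma past_max_ge m n : m <= n -> S m <= past_max S n.
Proof. by have [_] := past_maxP (ub n); apply. Qed.

Lemma past_max_attained n : exists2 m, m <= n & S m = past_max S n.
Proof. by have [] := past_maxP (ub n). Qed.

Lemma past_max_recl n : past_max S n = Num.max (past_max S (n - 1)) (S n).
Proof.
apply: past_max_eq => [|m mn].
  have [m mn <-] := past_max_attained (n - 1).
  case: (leP (S m) (S n)) => h; first by exists n.
  by exists m => //; lia.
case: (ltP m n) => h; last by rewrite (_ : m = n); lia.
by have := past_max_ge m (n - 1); lia.
Qed.

Lemma past_max_le m n : m <= n -> past_max S m <= past_max S n.
Proof.
by move=> mn; have [k km <-] := past_max_attained m; apply: past_max_ge; lia.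
Qed.

(** With M the past maximum, TS at m >= n is at least M_m - 2 M_0 >= M_n - 2 M_0, with equality when
    S first reaches M_n from time n on; drift to the right makes this time finite. The future
    minimum of TS thus returns M up to a constant. *)
Lemma pitmanK : left_drift (mirror S) -> pitman_inv (pitman S) = S.
Proof.
move=> dR.
have fut n : future_min (pitman S) n = past_max S n - 2 * past_max S 0.
  rewrite future_min_mirror.
  rewrite (_ : past_max _ _ = 2 * past_max S 0 - past_max S n); first by lia.
  rewrite /mirror /pitman; apply: past_max_eq => [|m mn]; last first.
    have := past_max_ge (- m) (- m) (lexx _); have := past_max_le n (- m); lia.
  have ex : exists j : nat, past_max S n <= S (n + j%:Z).
    have [N hN] := dR (- past_max S n).
    exists (N + `|n|)%N; have := hN (- (n + (N + `|n|)%N%:Z)).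
    by rewrite /mirror opprK; lia.
  (* Steps have size 1, so at its first passage the path equals [past_max S n] exactly. *)
  case: (ex_minnP ex) => j hj minj.
  have e : S (n + j%:Z) = past_max S n.
    case: j hj minj => [|j] hj minj.
      by have := past_max_ge n n (lexx _); move: hj; rewrite addr0; lia.
    have : S (n + j%:Z) < past_max S n by rewrite ltNge; apply/negP => /minj; lia.
    have [_ /(_ (n + j.+1%:Z))] := pS.
    by rewrite (_ : n + j.+1%:Z - 1 = n + j%:Z); lia.
  exists (- (n + j%:Z)); rewrite ?opprK; first by lia.
  rewrite (_ : past_max S (n + j%:Z) = past_max S n) ?e; first by lia.
  apply: past_max_eq => [|m mn']; first by exists (n + j%:Z).
  case: (leP m n) => mn; first exact: past_max_ge.
  case: (eqVneq m (n + j%:Z)) => [->|ne]; first by rewrite e.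
  rewrite leNgt; apply/negP => lt.
  have := minj (absz (m - n)%R); rewrite (_ : n + _ = m); last by lia.
  by move=> /(_ (ltW lt)); lia.
apply/funext => n; rewrite /pitman_inv !fut /pitman; lia.
Qed.

Lemma pitman_path : is_path (pitman S).
Proof. exact: pitman_is_path. Qed.

Lemma carrier_ge0 n : 0 <= carrier S n.
Proof. by rewrite /carrier; have := past_max_ge n n (lexx _); lia. Qed.

Lemma carrier_recl n : carrier S n =
  if config_of_path S n then carrier S (n - 1) + 1
  else Num.max (carrier S (n - 1) - 1) 0.
Proof.
rewrite /carrier past_max_recl /config_of_path.
have := pS.2 n; have := past_max_ge (n - 1) (n - 1) (lexx _).
by case: eqP; lia.
Qed.

(** The increment is reversed except where the past maximum rises, that is, at an up-step met by an
    empty carrier. *)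
Lemma config_of_pitman n : config_of_path (pitman S) n =
  ~~ config_of_path S n && (0 < carrier S (n - 1)).
Proof.
rewrite /carrier /config_of_path /pitman (past_max_recl n).
have := pS.2 n; have := past_max_ge (n - 1) (n - 1) (lexx _).
by case: eqP; case: eqP => /=; lia.
Qed.

(* A site that is empty at both times is one where the past maximum increases,
   so left drift produces such vacancies arbitrarily far to the left. *)
Lemma vacancy_exists n :
  exists2 m, m <= n & ~~ config_of_path S m && (carrier S (m - 1) == 0).
Proof.
apply: contrapT => no.
have step m : m <= n -> past_max S m = past_max S (m - 1).
  move=> mn; rewrite (past_max_recl m).
  have : ~~ (~~ config_of_path S m && (carrier S (m - 1) == 0)).
    by apply/negP => h; apply: no; exists m.
  rewrite /carrier /config_of_path; have := pS.2 m.
  have := past_max_ge (m - 1) (m - 1) (lexx _).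
  by case: eqP => /=; lia.
have const (j : nat) : past_max S (n - j%:Z) = past_max S n.
  elim: j => [|j IH]; first by rewrite subr0.
  by rewrite -IH (step (n - j%:Z)); [congr past_max; lia|lia].
have [N hN] := dS (past_max S n - 1).
have [m mn e] := past_max_attained (n - (N + `|n|)%N%:Z).
by have := hN m; rewrite e const; lia.
Qed.

End path_with_drift.

(** * Sub-critical paths *)

Section asymptotics.
Variable R : realType.
Implicit Types (F : int -> R) (S g G : int -> int).

(** A division-free form of g/F -> 1, equivalent to it for divergent [F] and suited to linear
    estimates. *)
Definition asymptotic F g : Prop := forall e : R, 0 < e ->
  exists N : nat, forall n : nat, (N <= n)%N -> `|(g n)%:~R - F n| <= e * F n.

Definition diverges F : Prop :=
  forall A : R, exists N : nat, forall n : nat, (N <= n)%N -> A < F n.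

Lemma ratio_near F S : (fun n : nat => (S n%:Z)%:~R / F n%:Z) @ \oo --> (1 : R) ->
  forall e : R, 0 < e -> e < 1 ->
  exists N : nat, forall n : nat, (N <= n)%N -> `|(S n)%:~R - F n| <= e * `|F n|.
Proof.
move=> /cvgrPdist_le h e e0 e1; have [N _ hN] := h e e0.
exists N => n /hN /=; have [->|Fn] := eqVneq (F n) 0.
  (* Division by zero makes the ratio 0, at distance 1 from the limit, which [e < 1] excludes. *)
  by rewrite invr0 mulr0 subr0 normr1; lra.
move=> he; rewrite (_ : _ - _ = F n * ((S n)%:~R / F n - 1)).
  by rewrite normrM mulrC ler_wpM2r// distrC.
by rewrite mulrBr mulrCA divff// !mulr1.
Qed.

(* A bounded increasing [F] cannot be tracked by a path, whose steps have size 1: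
   the increments of [F] are eventually at least 1/2. *)
Lemma subcritical_diverges F S : is_path S -> {homo F : m n / m < n} ->
  (fun n : nat => (S n%:Z)%:~R / F n%:Z) @ \oo --> (1 : R) -> diverges F.
Proof.
move=> [_ Sd] incF cF; apply: contrapT => nd.
have mono m n : m <= n -> F m <= F n.
  by rewrite le_eqVlt => /predU1P[->//|/incF/ltW].
have [A FA] : exists A, forall n : nat, F n <= A.
  apply: contrapT => nA; apply: nd => A.
  apply: contrapT => nN; apply: nA; exists A => n.
  rewrite leNgt; apply/negP => AF; apply: nN; exists n => m nm.
  by apply: (lt_le_trans AF); apply: mono.
pose B := `|A| + `|F 0| + 1.
have B0 : 0 < B by rewrite /B; have := normr_ge0 A; have := normr_ge0 (F 0); lra.
have FB (n : nat) : `|F n| <= B.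
  have le0n : (0 : int) <= n%:Z by [].
  rewrite ler_norml /B; have := FA n; have := mono 0 n%:Z le0n.
  have := ler_norm A; have := normr_ge0 A; have := normr_ge0 (F 0).
  by have := ler_norm (- F 0); rewrite normrN; lra.
(* The first bound turns the relative error into an absolute error of 1/4; the second keeps it below
   1, as [ratio_near] demands. *)
have B4 : 0 < Num.min (1 / (4 * B)) (1 / 2).
  by rewrite lt_min !divr_gt0 ?mulr_gt0//.
have [|N hN] := ratio_near F S cF _ B4; first by rewrite gt_min; apply/orP; right; lra.
have close (n : nat) : (N <= n)%N -> `|(S n)%:~R - F n| <= 1 / 4.
  move=> /hN /le_trans; apply.
  apply: (@le_trans _ _ (1 / (4 * B) * B)).
    by apply: ler_pM => //; [exact: ltW|rewrite ge_min lexx].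
  by rewrite le_eqVlt; apply/orP; left; apply/eqP; field; lra.
(* Two errors of 1/4 leave the increment of [F] within 1/2 of 1 or -1, and monotonicity rules out
   -1. *)
have incr (n : nat) : (N <= n)%N -> F n + 1 / 2 <= F n.+1.
  move=> Nn; have := close n Nn; have := close n.+1 (leqW Nn).
  have := mono n n.+1; have -> : (n%:Z <= n.+1%:Z) by lia.
  move=> /(_ isT); have := Sd n.+1; rewrite (_ : n.+1%:Z - 1 = n%:Z); last by lia.
  move=> e; have : (S n.+1)%:~R - (S n)%:~R = 1 :> R \/ (S n.+1)%:~R - (S n)%:~R = - 1 :> R.
    have [->|->] : S n.+1 = S n + 1 \/ S n.+1 = S n - 1 by lia.
      by left; rewrite intrD addrAC subrr add0r.
    by right; rewrite intrB addrAC subrr add0r.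
  by rewrite !ler_norml; move=> [?|?] ? /andP[? ?] /andP[? ?]; lra.
have grow (j : nat) : F N + j%:R / 2 <= F (N + j)%N.
  elim: j => [|j IH]; first by rewrite mul0r addr0 addn0.
  have -> : j.+1%:R = j%:R + 1 :> R by rewrite -natr1.
  by rewrite addnS; have := incr (N + j)%N (leq_addr _ _); lra.
have [j hj] : exists j : nat, 2 * (A - F N) < j%:R.
  exists (Num.truncn `|2 * (A - F N)|).+1.
  apply: (le_lt_trans (ler_norm _)); exact: truncnS_gt.
by have := grow j; have := FA (N + j)%N; lra.
Qed.

Lemma subcritical_posP S : subcritical_pos R S <->
  is_path S /\ exists F, [/\ {homo F : m n / m < n}, diverges F & asymptotic F S].
Proof.
split=> -[pS [F]].
  move=> [incF cF]; split=> //; exists F; split=> //.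
    exact: subcritical_diverges pS incF cF.
  move=> e e0.
  have [N1 h1] := subcritical_diverges F S pS incF cF 0.
  have e2 : 0 < Num.min e (1 / 2) by rewrite lt_min e0; lra.
  have [|N2 h2] := ratio_near F S cF _ e2; first by rewrite gt_min; apply/orP; right; lra.
  exists (maxn N1 N2) => n; rewrite geq_max => /andP[/h1 F0 /h2 /le_trans]; apply.
  by rewrite gtr0_norm// ler_pM2r// ge_min lexx.
move=> [incF dF aF]; split=> //; exists F; split=> //.
apply/cvgrPdist_le => e e0.
have [N1 h1] := dF 0; have [N2 h2] := aF e e0.
exists (maxn N1 N2) => // n /=; rewrite geq_max => /andP[/h1 F0 /h2 h].
rewrite (_ : 1 - _ = (F n - (S n)%:~R) / F n); last first.
  by rewrite mulrBl divff// gt_eqF.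
by rewrite normrM distrC normfV (gtr0_norm F0) ler_pdivrMr.
Qed.

Lemma subcritical_neg_mirror S : subcritical_neg R S <-> subcritical_pos R (mirror S).
Proof.
split=> -[pS [F [incF cF]]].
- split; first exact: mirror_is_path.
  exists (fun n => - F (- n)); split=> [m n mn|]; first by rewrite ltrN2 incF// ltrN2.
  rewrite (_ : (fun n : nat => _) = (fun n : nat => (S (- n%:Z))%:~R / F (- n%:Z)))//.
  by apply/funext => n; rewrite /mirror mulrNz invrN mulrNN.
- split; first by rewrite -(mirrorK S); exact: mirror_is_path.
  exists (fun n => - F (- n)); split=> [m n mn|]; first by rewrite ltrN2 incF// ltrN2.
  rewrite (_ : (fun n : nat => _) = (fun n : nat => (mirror S n%:Z)%:~R / F n%:Z))//.
  by apply/funext => n; rewrite /mirror opprK mulrNz mulNr invrN mulrN.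
Qed.

Lemma subcritical_mirror S : subcritical R S -> subcritical R (mirror S).
Proof.
move=> [n p]; split; last exact/subcritical_neg_mirror.
by apply/subcritical_neg_mirror; rewrite mirrorK.
Qed.

Lemma subcritical_pos_drift S : subcritical_pos R S -> left_drift (mirror S).
Proof.
move=> /subcritical_posP[_ [F [_ dF aF]]] A.
have [N1 h1] := dF (2 * `|A%:~R|); have [|N2 h2] := aF (1 / 2); first lra.
exists (maxn N1 N2) => m mN; rewrite /mirror lerNl.
have e : - m = (absz m)%:Z by lia.
rewrite e -(ler_int R); move: (h1 (absz m)) (h2 (absz m)).
have -> : (N1 <= absz m)%N by lia.
have -> : (N2 <= absz m)%N by lia.
move=> /(_ isT) ? /(_ isT); rewrite ler_norml mulrNz => /andP[? ?].
by have := ler_norm (- (A%:~R : R)); rewrite normrN; lra.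
Qed.

Lemma subcritical_drift S : subcritical R S ->
  [/\ is_path S, left_drift S & left_drift (mirror S)].
Proof.
move=> [n p]; split; [by case: p| |exact: subcritical_pos_drift].
by rewrite -(mirrorK S); apply/subcritical_pos_drift/subcritical_neg_mirror.
Qed.

Lemma asymptotic_reflection F g G c : diverges F -> asymptotic F G -> asymptotic F g ->
  asymptotic F (fun n => 2 * G n - g n - 2 * c).
Proof.
move=> dF aG ag e e0.
(* Two fifths go to [G], one to [g] and one to the constant, which [F] eventually dominates. *)
have e5 : 0 < e / 5 by lra.
have [N1 h1] := aG _ e5; have [N2 h2] := ag _ e5.
have [N3 h3] := dF (`|2 * c%:~R| / (e / 5)).
exists (maxn N1 (maxn N2 N3)) => n; rewrite !geq_max => /and3P[/h1 + /h2 + /h3].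
rewrite ltr_pdivrMr// => b1 b2 b3.
rewrite !intrB !intrM.
have := ler_norm (2 * c%:~R : R); have := ler_norm (- (2 * c%:~R) : R); rewrite normrN => ? ?.
move: b1 b2; rewrite !ler_norml => /andP[? ?] /andP[? ?].
by apply/andP; split; lra.
Qed.

(** The past maximum follows the same [F]: it is at least [S n] and is attained at some m <= n,
    where either [S m] is bounded by a fixed maximum or it is at most (1 + e) F m <= (1 + e) F n. *)
Lemma pitman_subcritical_pos S : left_drift S ->
  subcritical_pos R S -> subcritical_pos R (pitman S).
Proof.
move=> dS /subcritical_posP[pS [F [incF dF aF]]].
have mono m n : m <= n -> F m <= F n.
  by rewrite le_eqVlt => /predU1P[->//|/incF/ltW].
apply/subcritical_posP; split; first exact: pitman_path.
exists F; split=> //; apply: asymptotic_reflection => // e e0.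
have [N hN] := aF e e0.
have [N' hN'] := dF (`|(past_max S N)%:~R| : R).
exists (maxn N N') => n; rewrite geq_max => /andP[Nn /hN' bN].
have Fn : 0 < F n by apply: le_lt_trans bN.
have lo : S n <= past_max S n by exact: past_max_ge.
have [m mn e1] := past_max_attained S pS dS n.
have := hN n Nn; move: lo; rewrite -(ler_int R) !ler_norml => lo /andP[l _].
apply/andP; split; first lra.
case: (leP m N) => mN.
  have := past_max_ge S pS dS m N mN; rewrite e1 -(ler_int R).
  have := ler_norm ((past_max S N)%:~R : R).
  have : 0 <= e * F n by rewrite mulr_ge0// ltW.
  lra.
have := hN (absz m); have -> : (absz m)%:Z = m by lia.
rewrite e1; have -> : (N <= absz m)%N by lia.
move=> /(_ isT); rewrite ler_norml => /andP[_].
have Fmn := mono m n mn; have : e * F m <= e * F n by rewrite ler_pM2l.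
lra.
Qed.

(** On the left the maximum is attained farther out, where the mirrored path is at least (1 - d)
    F(-m) >= (1 - d) F n. Capping d by 1/2 keeps the factor positive. *)
Lemma pitman_subcritical_neg S : subcritical_neg R S -> subcritical_neg R (pitman S).
Proof.
move=> nS; have pS : is_path S by case: nS.
move: nS => /subcritical_neg_mirror pos.
have dS : left_drift S by rewrite -(mirrorK S); exact: subcritical_pos_drift.
apply/subcritical_neg_mirror.
move: pos => /subcritical_posP[_ [F [incF dF aF]]].
have mono m n : m <= n -> F m <= F n.
  by rewrite le_eqVlt => /predU1P[->//|/incF/ltW].
apply/subcritical_posP; split; first by apply: mirror_is_path; exact: pitman_path.
exists F; split=> //.
have -> : mirror (pitman S) =
    (fun n => 2 * (mirror (past_max S)) n - mirror S n - 2 * - past_max S 0).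
  by apply/funext => n; rewrite /mirror /pitman; ring.
apply: asymptotic_reflection => // e e0.
have e2 : 0 < Num.min e (1 / 2) by rewrite lt_min e0; lra.
have [N hN] := aF _ e2; have [N' hN'] := dF 0.
exists (maxn N N') => n; rewrite geq_max => /andP[Nn /hN' Fn].
have hi : mirror (past_max S) n <= mirror S n by rewrite lerN2; exact: past_max_ge.
have [m mn e1] := past_max_attained S pS dS (- n%:Z).
have me : (absz m)%:Z = - m by lia.
have /ler_normlP[_ h1] := hN n Nn.
have /ler_normlP[h2 _] : `|(- past_max S (- n%:Z))%:~R - F (- m)| <= Num.min e (1 / 2) * F (- m).
  by have := hN (absz m); rewrite me {1}/mirror opprK e1; apply; lia.
have Fm : F n <= F (- m) by apply: mono; lia.
move: hi; rewrite -(ler_int R) => hi.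
have m1 : Num.min e (1 / 2) <= e by rewrite ge_min lexx.
have m2 : Num.min e (1 / 2) <= 1 / 2 by rewrite ge_min lexx orbT.
move: (Num.min e _) m1 m2 e2 h1 h2 => d m1 m2 e2 h1 h2.
have a1 : d * F n <= e * F n by rewrite ler_pM2r.
have a2 : (1 - d) * F n <= (1 - d) * F (- m) by rewrite ler_pM2l//; lra.
move: hi h2; rewrite {1 3}/mirror => hi h2.
rewrite ler_norml; apply/andP; split; lra.
Qed.

Lemma pitman_subcritical S : subcritical R S -> subcritical R (pitman S).
Proof.
move=> sS; have [pS dS _] := subcritical_drift S sS; case: sS => n p; split.
  exact: pitman_subcritical_neg.
exact: pitman_subcritical_pos.
Qed.

Lemma pitman_inv_subcritical S : subcritical R S -> subcritical R (pitman_inv S).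
Proof.
by move=> sS; rewrite pitman_inv_mirror; do !apply/subcritical_mirror || apply: pitman_subcritical.
Qed.

Lemma pitman_invK S : subcritical R S -> pitman (pitman_inv S) = S.
Proof.
move=> sS; have [pM dM dS] := subcritical_drift _ (subcritical_mirror S sS).
rewrite -[LHS]mirrorK pitman_inv_mirror -[in RHS](mirrorK S).
by rewrite -{2}(pitmanK _ pM dM dS) pitman_inv_mirror mirrorK.
Qed.

Lemma pitman_iter_subcritical S k : subcritical R S -> subcritical R (pitman_iter k S).
Proof.
move=> sS; case: k => n; rewrite /pitman_iter.
  by elim: n => //= n; exact: pitman_subcritical.
by elim: n.+1 => //= m; exact: pitman_inv_subcritical.
Qed.

Lemma pitman_iterS S k : subcritical R S ->
  pitman_iter (k + 1) S = pitman (pitman_iter k S).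
Proof.
move=> sS; case: k => [n|[|n]]; first by rewrite -PoszD addn1.
  by rewrite /= pitman_invK.
rewrite (_ : Negz n.+1 + 1 = Negz n); last by lia.
have := pitman_iter_subcritical S (Negz n) sS.
by move=> /pitman_invK {1}<-; congr pitman.
Qed.

Lemma pitman_iter_pitman S k : subcritical R S ->
  pitman_iter k (pitman S) = pitman_iter (k + 1) S.
Proof.
move=> sS; have [pS dS dM] := subcritical_drift S sS.
case: k => [n|[|n]].
- by rewrite -PoszD addn1 /pitman_iter -iterSr.
- by rewrite /= pitmanK.
rewrite (_ : Negz n.+1 + 1 = Negz n); last by lia.
by rewrite /pitman_iter iterSr pitmanK.
Qed.

End asymptotics.

(** * Reconstruction from the carrier at the origin *)

Lemma bbs_step_next u s v : bbs_step u s v -> even_recurrent u ->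
  (exists k, u k = 0) -> v = next_carrier u.
Proof.
move=> st r z; have e := bbs_step_occupation u s v st r z.
by case: st => [_ _ hv]; apply/funext => k; rewrite hv e.
Qed.

(** Recurrence at a site supplies an empty carrier there; the two together determine the next column
    and make it recurrent in turn. *)
Lemma spacetime_iter (f : int -> int -> int) (s : int -> int -> bool) :
  (forall n, bbs_step (f (n - 1)) (s n) (f n)) ->
  (forall n, even_recurrent (f n) -> exists k, f n k = 0) ->
  even_recurrent (f 0) ->
  forall m : nat, f m%:Z = iter m next_carrier (f 0) /\ s m.+1%:Z = occupation (f m%:Z).
Proof.
move=> fs fz r0 m.
have {}fs (i : nat) : bbs_step (f i%:Z) (s i.+1%:Z) (f i.+1%:Z).
  by have := fs i.+1%:Z; rewrite (_ : i.+1%:Z - 1 = i%:Z) //; lia.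
have r (i : nat) : even_recurrent (f i%:Z).
  by elim: i => [//|i IH]; exact: (bbs_step_even_recurrent _ _ _ (fs i) IH (fz _ IH)).
split; last exact: (bbs_step_occupation _ _ _ (fs m) (r m) (fz _ (r m))).
elim: m => [//|m IH].
by rewrite (bbs_step_next _ _ _ (fs m) (r m) (fz _ (r m))) IH.
Qed.

(** Positive sites are read at time 0 from the forward rule. The others use the reversed rule, where
    time 0 of an occupation becomes time 1. *)
Definition reconstruct (u : biseq int) : configuration := fun n =>
  match n with
  | Posz 0 => occupation (time_rev u) 1
  | Posz m.+1 => occupation (iter m next_carrier u) 0
  | Negz m => occupation (iter m.+1 next_carrier (time_rev u)) 1
  end.

Lemma subcritical_bbs_step (R : realType) S n : subcritical R S ->
  bbs_step (fun k => carrier (pitman_iter k S) (n - 1))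
    (fun k => config_of_path (pitman_iter k S) n)
    (fun k => carrier (pitman_iter k S) n).
Proof.
move=> sS; split=> k;
  have [pS dS _] := subcritical_drift _ _ (pitman_iter_subcritical _ S k sS).
- exact: carrier_ge0.
- by rewrite (pitman_iterS R)// config_of_pitman.
- exact: carrier_recl.
Qed.

Lemma reconstructK (R : realType) eta : subcritical_config R eta ->
  even_recurrent (carrier_at_origin eta) ->
  reconstruct (carrier_at_origin eta) = eta.
Proof.
rewrite /subcritical_config /=; set S := path_encoding eta => sS r0.
pose f n k := carrier (pitman_iter k S) n.
pose s n k := config_of_path (pitman_iter k S) n.
have fs n : bbs_step (f (n - 1)) (s n) (f n) by exact: (subcritical_bbs_step R).
(* Otherwise [no_vacancy] would forbid the time-0 vacancy that drift provides to the left of [n]. *)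
have fz n : even_recurrent (f n) -> exists k, f n k = 0.
  move=> r; apply: contrapT => nz.
  have [pS dS _] := subcritical_drift R S sS.
  have [m mn] := vacancy_exists S pS dS n.
  have := no_vacancy f s fs n r _ m 0 mn.
  have nz' k : f n k != 0 by apply/eqP => e; apply: nz; exists k.
  by move=> /(_ nz'); rewrite /s /f /=; case: config_of_path => //=; lia.
have s0 n : s n 0 = eta n by rewrite /s /= path_encodingK.
(* In reversed space, site 1-n lies between the carriers at 1-n and -n, hence the offset in the
   index of [s]. *)
have left m : s (- m%:Z) 0 = occupation (iter m next_carrier (time_rev (f 0))) 1.
  have := spacetime_iter (fun n => time_rev (f (- n))) (fun n k => s (1 - n) (1 - k)).
  case/(_ _ _ _ m)=> [n|n rn||e1].
  - have := bbs_step_rev _ _ _ (fs (1 - n)).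
    by rewrite (_ : 1 - n - 1 = - n) 1?(_ : - (n - 1) = 1 - n); lia || exact.
  - have [|k fk] := fz (- n); last by exists (- k); rewrite /time_rev opprK.
    move: (even_recurrent_rev _ rn); congr even_recurrent.
    by apply/funext => k; rewrite /time_rev opprK.
  - by rewrite oppr0; exact: even_recurrent_rev.
  rewrite oppr0 in e1 *; rewrite e1 => /(congr1 (fun g => g 1)) <-.
  by congr s; lia.
apply/funext => -[[|m]|m]; rewrite -s0 /reconstruct.
- exact: esym (left 0%N).
- by have [-> ->] := spacetime_iter f s fs fz r0 m.
- by rewrite NegzE left.
Qed.

(** * Measurability *)

Section measurability.
Context {d : measure_display} {T : measurableType d}.

Lemma measurable_exists (I : countType) (Q : I -> T -> Prop) :
  (forall i, measurable [set x | Q i x]) -> measurable [set x | exists i, Q i x].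
Proof.
move=> mQ; rewrite (_ : [set x | _] = \bigcup_i [set x | Q i x]).
  by apply: countable_bigcupT_measurable.
by apply/seteqP; split=> x [i]; exists i.
Qed.

Lemma measurable_not (Q : T -> Prop) :
  measurable [set x | Q x] -> measurable [set x | ~ Q x].
Proof. exact: measurableC. Qed.

Lemma measurable_and (Q Q' : T -> Prop) :
  measurable [set x | Q x] -> measurable [set x | Q' x] ->
  measurable [set x | Q x /\ Q' x].
Proof. exact: measurableI. Qed.

Lemma measurable_forall (I : countType) (Q : I -> T -> Prop) :
  (forall i, measurable [set x | Q i x]) -> measurable [set x | forall i, Q i x].
Proof.
move=> mQ; rewrite (_ : [set x | _] = [set x | ~ exists i, ~ Q i x]).
  by apply/measurable_not/measurable_exists => i; exact: measurable_not.
apply/seteqP; split=> x /= h; first by move=> [i]; apply.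
by move=> i; apply: contrapT => nQ; apply: h; exists i.
Qed.

Lemma measurable_prop (Q : Prop) : measurable [set _ : T | Q].
Proof.
case: (pselect Q) => q; first by rewrite (_ : [set _ | Q] = setT)// -subTset.
by rewrite (_ : [set _ | Q] = set0)// -subset0.
Qed.

Lemma measurable_imply (Q : Prop) (Q' : T -> Prop) :
  measurable [set x | Q' x] -> measurable [set x | Q -> Q' x].
Proof.
move=> mQ'; case: (pselect Q) => q.
  rewrite (_ : [set x | _] = [set x | Q' x])//.
  by apply/seteqP; split=> x /=; auto.
rewrite (_ : [set x | _] = setT)//.
by apply/seteqP; split=> x /= ? //.
Qed.

(** Asking for all preimages lets such maps be combined by arbitrary operations on countable types,
    as in [discrete_fun2]. *)
Definition discrete_fun {V : Type} (f : T -> V) : Prop :=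
  forall A : set V, measurable (f @^-1` A).

Lemma discrete_funP (V : countType) (f : T -> V) :
  (forall c, measurable [set x | f x = c]) -> discrete_fun f.
Proof.
move=> mf A.
rewrite (_ : f @^-1` A = [set x | exists c, f x = c /\ A c]).
  by apply: measurable_exists => c; apply: measurable_and (mf c) (measurable_prop _).
by apply/seteqP; split=> x /= => [Ax|[c [<-]]]//; exists (f x).
Qed.

Lemma discrete_fun2 (V1 V2 : countType) (V : Type) (h : V1 -> V2 -> V)
    (f : T -> V1) (g : T -> V2) :
  discrete_fun f -> discrete_fun g -> discrete_fun (fun x => h (f x) (g x)).
Proof.
move=> mf mg A.
rewrite (_ : _ @^-1` A = [set x | exists a, exists b, (f x = a /\ g x = b) /\ A (h a b)]).
  apply: measurable_exists => a; apply: measurable_exists => b.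
  apply: measurable_and (measurable_prop _).
  exact: measurable_and (mf [set a]) (mg [set b]).
apply/seteqP; split=> x /= => [Ax|[a [b [[<- <-]]]]]//.
by exists (f x); exists (g x).
Qed.

Lemma discrete_fun_cst (V : Type) (c : V) : discrete_fun (fun _ : T => c).
Proof. by move=> A; exact: measurable_prop. Qed.

Lemma measurable_biseq {d'} {V : measurableType d'} (f : T -> biseq V) :
  (forall k, measurable_fun setT (fun x => f x k)) -> measurable_fun setT f.
Proof.
move=> mf; apply: (@measurability _ _ T (biseq V) setT f (cylinders V) erefl).
move=> _ [_ [k _ [B mB <-]] <-].
by rewrite !setTI; have := mf k measurableT B mB; rewrite setTI.
Qed.

Lemma measurable_biseq_discrete {d'} {V : measurableType d'} (f : T -> biseq V) :
  (forall k, discrete_fun (fun x => f x k)) -> measurable_fun setT f.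
Proof. by move=> mf; apply: measurable_biseq => k _ B _; rewrite setTI; exact: mf. Qed.

Lemma measurable_past_max (S : T -> int -> int) n :
  (forall k, discrete_fun (fun x => S x k)) -> discrete_fun (fun x => past_max (S x) n).
Proof.
move=> mS; apply: discrete_funP => c.
pose Q x := exists b, forall m, m <= n -> S x m <= b.
have mQ : measurable [set x | Q x].
  apply: measurable_exists => b; apply: measurable_forall => m; apply: measurable_imply.
  exact: (mS m [set i | i <= b]).
have hub x : Q x <-> has_ubound [set S x m | m in [set m | m <= n]].
  split=> -[b hb]; exists b; first by move=> _ [m mn <-]; exact: hb.
  by move=> m mn; apply: hb; exists m.
(* A level set splits into an attained maximum and, for unbounded pasts, the default value. *)
rewrite (_ : [set x | _] = [set x | ((exists m, m <= n /\ S x m = c) /\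
    (forall m, m <= n -> S x m <= c))] `|` [set x | ~ Q x /\ 0 = c]).
  apply: measurableU.
    apply: measurable_and.
      apply: measurable_exists => m; apply: measurable_and (measurable_prop _) _.
      exact: (mS m [set c]).
    apply: measurable_forall => m; apply: measurable_imply.
    exact: (mS m [set i | i <= c]).
  by apply: measurable_and (measurable_prop _); exact: measurable_not.
apply/seteqP; split=> x /=.
  case: (pselect (Q x)) => [/hub/past_maxP[[m mn e] max] <-|nQ <-].
    by left; split=> //; exists m.
  by right; rewrite past_max_unbounded// => /hub.
case=> [[[m [mn e]] max]|[nQ <-]]; first by apply: past_max_eq => //; exists m.
by apply: past_max_unbounded => /hub.
Qed.

Lemma measurable_pitman (S : T -> int -> int) :
  (forall k, discrete_fun (fun x => S x k)) -> forall n, discrete_fun (fun x => pitman (S x) n).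
Proof.
move=> mS n; have mM := measurable_past_max S ^~ mS.
have := discrete_fun2 _ _ _ (fun a b : int => a - 2 * b) _ _
  (discrete_fun2 _ _ _ (fun a b : int => 2 * a - b) _ _ (mM n) (mS n)) (mM 0).
exact.
Qed.

Lemma measurable_mirror (S : T -> int -> int) :
  (forall k, discrete_fun (fun x => S x k)) -> forall n, discrete_fun (fun x => mirror (S x) n).
Proof. by move=> mS n A; exact: (mS (- n) [set i | A (- i)]). Qed.

Lemma measurable_pitman_iter (S : T -> int -> int) k :
  (forall k, discrete_fun (fun x => S x k)) ->
  forall n, discrete_fun (fun x => pitman_iter k (S x) n).
Proof.
move=> mS; case: k => j; rewrite /pitman_iter.
  by elim: j => [//|j IH] n; exact: measurable_pitman.
elim: j.+1 => [//|i IH] n /=.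
rewrite (_ : (fun x => _) = (fun x => mirror (pitman (mirror (iter i pitman_inv (S x)))) n)).
  by apply: measurable_mirror; apply: measurable_pitman; apply: measurable_mirror.
by apply/funext => x; rewrite pitman_inv_mirror.
Qed.

Lemma measurable_occupation (u : T -> int -> int) :
  (forall k, discrete_fun (fun x => u x k)) ->
  forall k, discrete_fun (fun x => occupation (u x) k).
Proof.
move=> mu k.
have m1 : measurable [set x | occupation (u x) k].
  rewrite (_ : [set x | _] = [set x | exists j : nat, u x (k - 1 - j%:Z) = 0 /\
      ((forall i : nat, (i < j)%N -> u x (k - 1 - i%:Z) != 0) /\ odd j)]).
    apply: measurable_exists => j.
    apply: measurable_and; first exact: (mu _ [set 0]).
    apply: measurable_and (measurable_prop _).
    apply: measurable_forall => i; apply: measurable_imply.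
    exact: (mu _ [set a | a != 0]).
  apply/seteqP; split=> x /=; first by move=> /asboolP[j [? ? ?]]; exists j.
  by move=> [j [? [? ?]]]; apply/asboolP; exists j.
apply: discrete_funP => -[//|].
rewrite (_ : [set x | _] = [set x | ~ occupation (u x) k]); first exact: measurable_not.
by apply/seteqP; split=> x /=; case: occupation.
Qed.

Lemma measurable_next_carrier (u : T -> int -> int) :
  (forall k, discrete_fun (fun x => u x k)) ->
  forall k, discrete_fun (fun x => next_carrier (u x) k).
Proof.
move=> mu k.
exact: (discrete_fun2 _ _ _ (fun (b : bool) (a : int) => if b then a + 1 else Num.max (a - 1) 0)
  _ _ (measurable_occupation u mu k) (mu k)).
Qed.

Lemma measurable_next_carrier_iter (u : T -> int -> int) m :
  (forall k, discrete_fun (fun x => u x k)) ->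
  forall k, discrete_fun (fun x => iter m next_carrier (u x) k).
Proof. by move=> mu; elim: m => [//|m IH]; exact: measurable_next_carrier. Qed.

End measurability.

Lemma discrete_coord {d} {V : measurableType d} k :
  (forall A : set V, measurable A) -> discrete_fun (fun x : biseq V => x k).
Proof.
move=> mV A; apply: sub_sigma_algebra; exists k => //.
by exists A => //; rewrite setTI.
Qed.

Lemma measurable_reconstruct : measurable_fun setT reconstruct.
Proof.
have mu k : discrete_fun (fun u : biseq int => u k) by exact: discrete_coord.
have mr k : discrete_fun (fun u : biseq int => time_rev u k) by exact: mu.
apply: measurable_biseq_discrete => -[[|m]|m].
- exact: measurable_occupation.
- by apply: measurable_occupation; exact: measurable_next_carrier_iter.
- by apply: measurable_occupation; exact: measurable_next_carrier_iter.
Qed.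

Lemma measurable_path_encoding k :
  discrete_fun (fun eta : configuration => path_encoding eta k).
Proof.
have mi n : discrete_fun (fun eta : configuration => increment eta n).
  by move=> A; exact: (@discrete_coord _ bool n _ [set b : bool | A (1 - 2 * (nat_of_bool b)%:Z)]).
elim/int_ind: k => [|k IH|k IH].
- rewrite (_ : (fun _ => _) = (fun=> 0)); first exact: discrete_fun_cst.
  by apply/funext => eta; exact: (path_encoding_is_path eta).1.
- rewrite (_ : (fun _ => _) = (fun eta => path_encoding eta k%:Z + increment eta k.+1)).
    exact: (discrete_fun2 _ _ _ (fun a b : int => a + b)).
  apply/funext => eta; rewrite -path_encodingB (_ : k.+1%:Z - 1 = k%:Z); last by lia.
  by rewrite addrC subrK.
- rewrite (_ : (fun _ => _) = (fun eta => path_encoding eta (- k%:Z) - increment eta (- k%:Z))).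
    exact: (discrete_fun2 _ _ _ (fun a b : int => a - b)).
  apply/funext => eta; rewrite -path_encodingB (_ : - k%:Z - 1 = - k.+1%:Z); last by lia.
  by rewrite subKr.
Qed.

Lemma measurable_bbs : measurable_fun setT bbs.
Proof.
have mS := measurable_pitman _ measurable_path_encoding.
apply: measurable_biseq_discrete => n.
exact: (discrete_fun2 _ _ _ (fun a b : int => a - b == - 1) _ _ (mS n) (mS (n - 1))).
Qed.

Lemma measurable_carrier_at_origin : measurable_fun setT carrier_at_origin.
Proof.
apply: measurable_biseq_discrete => k.
have mS := measurable_pitman_iter _ k measurable_path_encoding.
exact: (discrete_fun2 _ _ _ (fun a b : int => a - b) _ _ (measurable_past_max _ 0 mS) (mS 0)).
Qed.

Lemma measurable_biseq_shift : measurable_fun setT (biseq_shift int).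
Proof. by apply: measurable_biseq_discrete => k; exact: discrete_coord. Qed.

(** * Recurrence *)

Lemma ae_measure_eq {d} {T : measurableType d} {R : realType}
    (mu : {measure set T -> \bar R}) (A B : set T) : measurable A -> measurable B ->
  {ae mu, forall x, A x <-> B x} -> mu A = mu B.
Proof.
move=> mA mB [N [mN N0 sN]].
have le (C C' : set T) : measurable C -> measurable C' -> C `<=` C' `|` N ->
    (mu C <= mu C')%E.
  move=> mC mC' CC'; apply: (@le_trans _ _ (mu (C' `|` N))).
    by apply: le_measure; rewrite ?inE//; exact: measurableU.
  have : (mu (C' `|` N) <= mu C' + mu N)%E by exact: measureU2.
  by rewrite N0 adde0.
apply/eqP; rewrite eq_le; apply/andP; split; apply: le => // x Cx.
  by case: (pselect (B x)); [left|move=> nB; right; apply: sN => /= -[/(_ Cx)]].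
by case: (pselect (A x)); [left|move=> nA; right; apply: sN => /= -[_ /(_ Cx)]].
Qed.

Lemma ae_forall_countable {d} {T : measurableType d} {R : realType}
    (mu : {measure set T -> \bar R}) (I : countType) (Q : I -> T -> Prop) :
  (forall i, {ae mu, forall x, Q i x}) -> {ae mu, forall x, forall i, Q i x}.
Proof.
move=> aQ.
have : {ae mu, forall x, forall n, if unpickle n is Some i then Q i x else True}.
  by apply: ae_foralln => n; case: unpickle => [i|]; [exact: aQ|exact: aeW].
by apply: filterS => x h i; have := h (pickle i); rewrite pickleK.
Qed.

(* The sets [visits m] of points visiting [E] at some time at least [m] decrease
   in [m] and are mapped to each other by [f], so they differ by null sets. *)
Lemma poincare_recurrence {d d'} {Omega : measurableType d} {T : measurableType d'}
    {R : realType} (P : probability Omega R) (X : Omega -> T) (f : T -> T) (E : set T) :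
  measurable_fun setT X -> measurable_fun setT f ->
  preserves (pushforward P X) f -> measurable E ->
  {ae P, forall w, E (X w) -> forall K : nat, exists2 n, (K <= n)%N & E (iter n f (X w))}.
Proof.
move=> mX mf pf mE.
pose visits m := [set x | exists2 n, (m <= n)%N & E (iter n f x)].
have mpre (g : T -> T) A : measurable_fun setT g -> measurable A -> measurable (g @^-1` A).
  by move=> mg mA; rewrite -[_ @^-1` _]setTI; exact: mg.
have mvisits m : measurable (visits m).
  rewrite (_ : visits m = \bigcup_(n in [set n | (m <= n)%N]) iter n f @^-1` E)//.
  apply: bigcup_measurable => n _; apply: mpre => //.
  by elim: n => [|n IH]; [exact: measurable_id|exact: measurableT_comp].
have visitsS m : f @^-1` visits m = visits m.+1.
  apply/seteqP; split=> x /= [n mn].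
    by rewrite -iterSr; exists n.+1.
  by case: n mn => // n mn; rewrite iterSr; exists n.
have mXpre A : measurable A -> measurable (X @^-1` A).
  by move=> mA; rewrite -[_ @^-1` _]setTI; exact: mX.
have Pvisits m : P (X @^-1` visits m) = P (X @^-1` visits 0%N).
  elim: m => [//|m <-]; rewrite -visitsS; exact: pf.
have null m : P (X @^-1` visits 0%N `\` X @^-1` visits m) = 0%E.
  have fin A : measurable A -> P (X @^-1` A) \is a fin_num.
    by move=> mA; apply: fin_num_measure; exact: mXpre.
  rewrite measureD; [|exact: mXpre|exact: mXpre|by rewrite -ge0_fin_numE// fin].
  rewrite setIidr; last by move=> w [n _ En]; exists n.
  apply: (etrans (congr1 (fun y => P (X @^-1` visits 0%N) - y)%E (Pvisits m))).
  exact/subee/fin.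
have : {ae P, forall w, forall m, ~ (X @^-1` visits 0%N `\` X @^-1` visits m) w}.
  apply: ae_foralln => m; exists (X @^-1` visits 0%N `\` X @^-1` visits m); split.
  - by apply: measurableD; exact: mXpre.
  - exact: null.
  - by move=> w /contrapT.
apply: filterS => w h Ew K; apply: contrapT => nK; apply: (h K); split; last exact: nK.
by exists 0%N.
Qed.

Lemma preserves_inverse {d} {T : measurableType d} {R : realType}
    (mu : set T -> \bar R) (f g : T -> T) : measurable_fun setT g ->
  cancel f g -> preserves mu f -> preserves mu g.
Proof.
move=> mg fK pf A mA; rewrite -[LHS](pf (g @^-1` A)); last first.
  by rewrite -[_ @^-1` _]setTI; exact: mg.
by congr mu; apply/seteqP; split=> x /=; rewrite fK.
Qed.

(** Poincare recurrence is applied to the shifts by 2 and -2 and to the events that a window spells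
    a given integer word; there are countably many of these. *)
Lemma stationary_even_recurrent {d} {Omega : measurableType d} {R : realType}
    (P : probability Omega R) (X : Omega -> biseq int) : measurable_fun setT X ->
  preserves (pushforward P X) (biseq_shift int) ->
  {ae P, forall w, even_recurrent (X w)}.
Proof.
move=> mX st.
pose f (e : int) (x : biseq int) : biseq int := fun k => x (k + e).
have mf e : measurable_fun setT (f e).
  by apply: measurable_biseq_discrete => k; exact: discrete_coord.
have fD e e' : f e \o f e' = f (e' + e).
  by apply/funext => x; apply/funext => k; rewrite /f /= addrA addrAC.
have mpre e B : measurable B -> measurable (f e @^-1` B).
  by move=> mB; rewrite -[_ @^-1` _]setTI; exact: mf.
have comp e e' : preserves (pushforward P X) (f e) -> preserves (pushforward P X) (f e') ->
    preserves (pushforward P X) (f (e + e')).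
  move=> pe pe' B mB; rewrite -fD; exact: etrans (pe _ (mpre _ _ mB)) (pe' _ mB).
have p1 : preserves (pushforward P X) (f 1) by exact: st.
have p2 : preserves (pushforward P X) (f 2) by exact: comp.
have pN2 : preserves (pushforward P X) (f (- 2)).
  apply: (preserves_inverse _ (f 2)) => // x.
  by apply/funext => k; rewrite /f -addrA addNr addr0.
have iterf e n x k : iter n (f e) x k = x (k + n%:Z * e).
  elim: n k => [|n IH] k; first by rewrite mul0r addr0.
  by rewrite iterS {1}/f IH; congr x; lia.
pose word (N : nat) (c : seq int) : set (biseq int) :=
  [set x | forall k : int, `|k| <= N%:Z -> x k = nth 0 c (absz (k + N%:Z)%R)].
have mword N c : measurable (word N c).
  apply: measurable_forall => k; apply: measurable_imply.
  exact: (@discrete_coord _ int k _ [set nth 0 c (absz (k + N%:Z)%R)]).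
have rec e : preserves (pushforward P X) (f e) -> {ae P, forall w, forall i : nat * seq int,
    word i.1 i.2 (X w) ->
    forall K : nat, exists2 n, (K <= n)%N & word i.1 i.2 (iter n (f e) (X w))}.
  by move=> pe; apply: ae_forall_countable => i; exact: poincare_recurrence.
apply: filterS2 (rec _ p2) (rec _ pN2) => w r2 rN2 N K.
(* The word actually seen in the window, with index [k + N] for time [k]. *)
pose c := mkseq (fun i => X w (i%:Z - N%:Z)) (N + N).+1.
have cE k : `|k| <= N%:Z -> nth 0 c (absz (k + N%:Z)%R) = X w k.
  by move=> kN; rewrite nth_mkseq; [congr (X w); lia|lia].
have wc : word N c (X w) by move=> k kN; rewrite cE.
have [n Kn hn] := r2 (N, c) wc K; have [m Km hm] := rN2 (N, c) wc K.
split; [exists n%:Z => [|k kN]|exists (- m%:Z) => [|k kN]]; try lia.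
  by have := hn k kN; rewrite iterf /= cE// => <-; congr (X w); lia.
by have := hm k kN; rewrite iterf /= cE// => <-; congr (X w); lia.
Qed.

Lemma even_recurrent_shift (x : biseq int) :
  even_recurrent x -> even_recurrent (biseq_shift int x).
Proof.
move=> r N K; have [[p Kp hp] [q Kq hq]] := r N.+1 K; rewrite /biseq_shift.
split; [exists p => // k kN|exists q => // k kN].
  by rewrite addrAC hp//; lia.
by rewrite addrAC hq//; lia.
Qed.

(** * Conjugation of the dynamics with the shift *)

Section dynamics.
Variable R : realType.
Local Notation D := (subcritical_config R).

Lemma subcritical_bbs eta : D eta -> path_encoding (bbs eta) = pitman (path_encoding eta).
Proof.
move=> sS; have [pS dS _] := subcritical_drift R _ sS.
by apply: path_encoding_bbs; exact: left_drift_ub.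
Qed.

Lemma bbs_subcritical eta : D eta -> D (bbs eta).
Proof.
by move=> De; rewrite /subcritical_config /= subcritical_bbs//; exact: pitman_subcritical.
Qed.

(** The semiconjugacy on [D]; where the carrier sequence is recurrent, [reconstructK] inverts it. *)
Lemma carrier_at_origin_bbs eta : D eta ->
  carrier_at_origin (bbs eta) = biseq_shift int (carrier_at_origin eta).
Proof.
move=> De; apply/funext => k; rewrite /carrier_at_origin /biseq_shift subcritical_bbs//.
by rewrite (pitman_iter_pitman R).
Qed.

Lemma iter_bbs eta n : D eta -> D (iter n bbs eta) /\
  carrier_at_origin (iter n bbs eta) = iter n (biseq_shift int) (carrier_at_origin eta).
Proof.
move=> De; elim: n => [//|n [IHD IH]] /=; split; first exact: bbs_subcritical.
by rewrite carrier_at_origin_bbs// IH.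
Qed.

End dynamics.

Theorem theorem1p6 (R : realType) (d : measure_display)
    (Omega : measurableType d) (P : probability Omega R)
    (eta : {RV P >-> configuration})
    (eta_subcritical : {ae P, forall w, subcritical_config R (eta w)}) :
  (same_law P (bbs \o eta) eta <->
   preserves (pushforward P (carrier_at_origin \o eta)) (biseq_shift int))
  /\
  ((preserves (distribution P eta) bbs /\
    ergodic_on (subcritical_config R) (distribution P eta) bbs) <->
   (preserves (pushforward P (carrier_at_origin \o eta)) (biseq_shift int) /\
    ergodic_on setT (pushforward P (carrier_at_origin \o eta))
      (biseq_shift int))).
Proof.
have meta A : measurable A -> measurable (eta @^-1` A).
  by move=> mA; rewrite -[_ @^-1` _]setTI; apply: (measurable_funPT eta).
have mphi A : measurable A -> measurable (carrier_at_origin @^-1` A).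
  by move=> mA; rewrite -[_ @^-1` _]setTI; exact: measurable_carrier_at_origin.
have mbbs A : measurable A -> measurable (bbs @^-1` A).
  by move=> mA; rewrite -[_ @^-1` _]setTI; exact: measurable_bbs.
have mshift A : measurable A -> measurable (biseq_shift int @^-1` A).
  by move=> mA; rewrite -[_ @^-1` _]setTI; exact: measurable_biseq_shift.
have mrec A : measurable A -> measurable (reconstruct @^-1` A).
  by move=> mA; rewrite -[_ @^-1` _]setTI; exact: measurable_reconstruct.
pose nu := pushforward P (carrier_at_origin \o eta).
have aerec : preserves nu (biseq_shift int) ->
    {ae P, forall w, even_recurrent (carrier_at_origin (eta w))}.
  apply: stationary_even_recurrent; apply: measurableT_comp.
    exact: measurable_carrier_at_origin.
  exact: (measurable_funPT eta).
have law : preserves (distribution P eta) bbs <-> preserves nu (biseq_shift int).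
  split=> [inv B mB|st A mA].
    rewrite -[RHS](inv _ (mphi _ mB)).
    change (P (eta @^-1` (carrier_at_origin @^-1` (biseq_shift int @^-1` B))) =
            P (eta @^-1` (bbs @^-1` (carrier_at_origin @^-1` B)))).
    apply: ae_measure_eq.
    - exact: (meta _ (mphi _ (mshift _ mB))).
    - exact: (meta _ (mbbs _ (mphi _ mB))).
    by apply: filterS eta_subcritical => w Dw /=; rewrite (carrier_at_origin_bbs R).
  change (P (eta @^-1` (bbs @^-1` A)) = P (eta @^-1` A)).
  have := st _ (mrec _ mA); rewrite /nu /pushforward => st_A.
  (* Almost surely [bbs] of the configuration is the reconstruction of the shifted carrier sequence;
     stationarity then removes the shift. *)
  transitivity (P (eta @^-1`
    (carrier_at_origin @^-1` (biseq_shift int @^-1` (reconstruct @^-1` A))))).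
    apply: ae_measure_eq.
    - exact: (meta _ (mbbs _ mA)).
    - exact: (meta _ (mphi _ (mshift _ (mrec _ mA)))).
    apply: filterS2 eta_subcritical (aerec st) => w Dw rw /=.
    rewrite -(carrier_at_origin_bbs R)// (reconstructK R)//; first exact: bbs_subcritical.
    by rewrite (carrier_at_origin_bbs R)//; exact: even_recurrent_shift.
  rewrite [LHS]st_A; apply: ae_measure_eq; [exact: (meta _ (mphi _ (mrec _ mA)))|exact: meta|].
  by apply: filterS2 eta_subcritical (aerec st) => w Dw rw /=; rewrite (reconstructK R).
split; first exact: law.
split=> -[st erg]; split; try exact/law.
  (* By the semiconjugacy, the pullback of a shift-invariant event is invariant on the sub-critical
     set. *)
  move=> B mB; rewrite !setTI => invB; apply: (erg _ (mphi _ mB)).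
  apply/seteqP; split=> e [De] /= h; split=> //.
    by rewrite -invB /= -(carrier_at_origin_bbs R).
  by rewrite (carrier_at_origin_bbs R)//; move: h; rewrite -{1}invB.
move=> A mA invA.
(* [reconstruct @^-1` A] is shift-invariant only almost surely; the set of
   sequences visiting it infinitely often is exactly so. *)
pose B := [set x | forall m : nat, exists n : nat, (m <= n)%N /\
  A (reconstruct (iter n (biseq_shift int) x))].
have mB : measurable B.
  apply: measurable_forall => m; apply: measurable_exists => n.
  apply: measurable_and (measurable_prop _) _.
  elim: n => [|n IH]; first exact: mrec.
  rewrite (_ : [set x | _] = biseq_shift int @^-1`
    [set x | A (reconstruct (iter n (biseq_shift int) x))]); first exact: mshift.
  by apply/seteqP; split=> x; rewrite /= -iterSr.
have invB : biseq_shift int @^-1` B = B.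
  apply/seteqP; split=> x /= hx m.
    by have [n [mn h]] := hx m; exists n.+1; rewrite iterSr; split=> //; exact: leqW.
  have [[|n] [mn h]] := hx m.+1; first by [].
  by exists n; split=> //; move: h; rewrite iterSr.
suff -> : distribution P eta A = nu B by apply: erg => //; rewrite !setTI.
change (P (eta @^-1` A) = P (eta @^-1` (carrier_at_origin @^-1` B))).
apply: ae_measure_eq; [exact: meta|exact: (meta _ (mphi _ mB))|].
apply: filterS2 eta_subcritical (aerec st) => w Dw rw /=.
(* The shifted sequence reconstructs the n-th iterate, and [A] is invariant on [D], so visiting [A]
   at one time, at infinitely many, or at time 0 are all equivalent. *)
have visit n : A (reconstruct (iter n (biseq_shift int) (carrier_at_origin (eta w)))) <-> A (eta w).
  have rn : even_recurrent (iter n (biseq_shift int) (carrier_at_origin (eta w))).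
    by elim: n => //= n; exact: even_recurrent_shift.
  have [Dn e] := iter_bbs R (eta w) n Dw; rewrite -e (reconstructK R)// ?e//.
  elim: n {rn e} Dn => //= n IH Dn.
  have [Dn' _] := iter_bbs R (eta w) n Dw; rewrite -(IH Dn').
  have AE e : subcritical_config R e -> A (bbs e) <-> A e.
    move=> De; split=> h.
      by have [] : (subcritical_config R `&` A) e by rewrite -invA.
    by have [] : (subcritical_config R `&` bbs @^-1` A) e by rewrite invA.
  exact: AE.
split=> [Aw m|hB]; first by exists m; split=> //; apply/visit.
by have [n [_ /visit]] := hB 0%N.
Qed.
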